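(* Let $M,m,l,g>0$, $l_0\ge 0$ and $\tau\ge 0$ be real numbers. Let $P(s)=\dfrac{(l-l_0)s^2-g}{s^2\left(Mls^2-(M+m)g\right)}$, let $C$ be a controller for which the closed loop with loop gain $P(s)C(s)e^{-\tau s}$ is internally stable, and let $$T(s)=\frac{P(s)C(s)e^{-\tau s}}{1+P(s)C(s)e^{-\tau s}}.$$ Put $p=\sqrt{\dfrac{(M+m)g}{Ml}}$ and, if $l_0<l$, put $q=\sqrt{\dfrac{g}{l-l_0}}$ and assume $p\ne q$. Define $$F=\begin{cases}\tau p, & l_0\ge l,\\[2pt] \tau p+\ln\left|\dfrac{p+q}{p-q}\right|, & l_0<l.\end{cases}$$ Then $$\ln\|T\|_\infty\ \ge\ F .$$
   Context: The setting is the linearization, about the upright position, of an inverted pendulum on a cart. Here $M$ is the cart mass, $m$ the effective stick mass, $l$ the effective stick length, $l_0$ the fixation (measurement) point along the stick, $g$ the gravitational acceleration, and $\tau$ the total feedback delay. The output of interest is $z$, the measurement is $y=z+n$ with sensor noise $n$, and $r$ is the actuation noise. $P$ is the transfer function from force to $z$. The closed loop is $\hat z=P(s)S(s)\hat r-T(s)\hat n$, where $S(s)=\frac{1}{1+P(s)C(s)e^{-\tau s}}$ is the sensitivity function and $T$ is the complementary sensitivity function. The controller $C$ is a proper real-rational transfer function. Internal stability means that $S$, $PS$, $CS$ and $T$ (after removal of removable singularities) are all analytic and bounded in the open right half plane $\{\operatorname{Re}s>0\}$; in particular there is no cancellation between $P$ and $C$ at right half plane poles or zeros, so that $T(p)=1$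 and, if $l_0<l$, $S(q)=1$. The $H_\infty$ norm is $\|G\|_\infty=\sup_{\omega\in\mathbb R}|G(j\omega)|=\sup_{\operatorname{Re}s>0}|G(s)|$, where $j$ is the imaginary unit. *)

(* Defs.v *)
(* MathComp-Analysis; the complex plane is [R[i]] (mathcomp-real-closed) over
   an arbitrary [R : realType]. *)
From mathcomp Require Import all_boot all_order all_algebra.
From mathcomp Require Import complex.
From mathcomp Require Import all_classical all_reals all_analysis.
Set Implicit Arguments.
Unset Strict Implicit.
Unset Printing Implicit Defensive.
Import Order.TTheory GRing.Theory Num.Theory.
Import numFieldNormedType.Exports.
Local Open Scope classical_set_scope.
Local Open Scope complex_scope.
Local Open Scope ring_scope.

(* Stated over an abstract [K : numFieldType], which carries the topology of
   its norm, and used below at [K = R[i]], where [derivable f s 1] is complex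
   differentiability at [s]. *)
Definition holomorphic (K : numFieldType) (D : set K) (f : K -> K) : Prop :=
  forall s, D s -> derivable f s 1.

(* [f] after removal of its removable singularities. The limit is taken over
   z <> s, so the value of [f] at [s] is irrelevant, in particular the one that
   the convention x / 0 = 0 produces at a pole of a factor of [f]. At a pole of
   [f] itself the limit does not exist and [regularize f] is not continuous. *)
Definition regularize (K : numFieldType) (f : K -> K) (s : K) : K :=
  lim (f z @[z --> s^']).

Section Complex.
Variable R : realType.
Implicit Types (z s : R[i]) (f P C : R[i] -> R[i]) (tau : R).

Definition cexp z : R[i] :=
  (expR (complex.Re z) * cos (complex.Im z))
    +i* (expR (complex.Re z) * sin (complex.Im z)).

Definition open_rhp : set R[i] := [set s | 0 < complex.Re s].

Definition bounded_rhp f : Prop :=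
  exists B : R, forall s, open_rhp s -> Normc.normc (f s) <= B.

(* The two expressions for the H-infinity norm: the supremum over the open
   right half plane and the supremum over the imaginary axis. *)
Definition hinf_norm f : R :=
  sup [set Normc.normc (f s) | s in open_rhp].

Definition hinf_norm_axis f : R :=
  sup (range (fun w : R => Normc.normc (f (0 +i* w)))).

(* The values of [C] at the finitely many roots of [den] are left free: they do
   not affect the regularized closed-loop functions. *)
Definition proper_real_rational C : Prop :=
  exists num den : {poly R},
    [/\ den != 0, (size num <= size den)%N &
        forall s, (map_poly (real_complex R) den).[s] != 0 ->
          C s = (map_poly (real_complex R) num).[s]
                / (map_poly (real_complex R) den).[s]].

Definition loop_gain P C tau s : R[i] :=
  P s * C s * cexp (- (tau%:C * s)).

Definition sensitivity P C tau s : R[i] :=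
  1 / (1 + loop_gain P C tau s).

Definition compl_sensitivity P C tau s : R[i] :=
  loop_gain P C tau s / (1 + loop_gain P C tau s).

Definition stable f : Prop :=
  holomorphic open_rhp (regularize f) /\ bounded_rhp (regularize f).

Definition internally_stable P C tau : Prop :=
  [/\ stable (sensitivity P C tau),
      stable (fun s => P s * sensitivity P C tau s),
      stable (fun s => C s * sensitivity P C tau s) &
      stable (compl_sensitivity P C tau)].

Definition pendulum (M m l l0 g : R) s : R[i] :=
  ((l - l0)%:C * s ^+ 2 - g%:C)
  / (s ^+ 2 * ((M * l)%:C * s ^+ 2 - ((M + m) * g)%:C)).

Definition pendulum_pole (M m l g : R) : R :=
  Num.sqrt ((M + m) * g / (M * l)).

(* Meaningful only for [l0 < l]. *)
Definition pendulum_zero (l l0 g : R) : R := Num.sqrt (g / (l - l0)).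

Definition fragility (M m l l0 g tau : R) : R :=
  let p := pendulum_pole M m l g in
  let q := pendulum_zero l l0 g in
  if l0 < l then tau * p + ln `|(p + q) / (p - q)| else tau * p.

End Complex.

(* Main.v *)
Require Import Defs.
From mathcomp Require Import all_boot all_order all_algebra.
From mathcomp Require Import complex.
From mathcomp Require Import all_classical all_reals all_analysis.
From mathcomp Require Import ring lra zify.
Import Order.TTheory GRing.Theory Num.Theory.
Local Open Scope ring_scope.
Import numFieldNormedType.Exports.
Import Normc.
Local Open Scope complex_scope.
Set Implicit Arguments.
Unset Strict Implicit.
Unset Printing Implicit Defensive.

(** Write the loop gain as [N/D] times the delay [exp (- tau s)], with
    polynomials [N] and [D], so that [T = N exp (- tau s) / X] with the
    characteristic function [X = D + N exp (- tau s)].  The delay and the zero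
    [q] of the plant are factors of [T] that can be divided out without changing
    the modulus on the imaginary axis: [G = T exp (tau s) (s + q) / (s - q)]
    (without the last fraction if [l <= l0]) satisfies [|G| = |T|] on the axis,
    and [T(p) = 1] gives [|G(p)| = exp F].  The bound is therefore the maximum
    principle [|G(p)| <= sup |G|] over the axis.

    [G] has no pole in the closed right half plane.  The numerators of the four
    closed-loop functions have no common zero there, so near a zero of [X] one
    of these functions would be unbounded, against internal stability
    ([charfun_neq0]).  The factor [s - q] cancels against the plant, which
    leaves [G] as a polynomial over [X].  Since [P] is strictly proper and [C] is
    proper, [G] tends to 0 at infinity in the half plane; hence [|G|] attains
    its maximum on the closed half plane, and this is why the ordinary maximum
    principle is enough although the domain is unbounded ([max_on_axis]).

    The maximum principle comes from a factorization ([epoly_factors_at]): a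
    function [A(z) + B(z) exp (c z)] with polynomials [A] and [B] either
    vanishes identically or equals [(z - s)^n F(z)] with [F] continuous and non-zero at
    [s].  For [X] this says that zeros are isolated, so that the regularized
    closed-loop functions are given by their formulas away from the zeros
    of [X].  For the numerator of [G - G(s)] it says that
    [G(z) = G(s) + (z - s)^n F(z)] near [s], and then [|G|] exceeds [|G(s)|] in
    the direction of a suitable [n]-th root ([not_local_max]).  The
    factorization is proved by induction on the degree of [A], because
    differentiating lowers this degree and keeps the form of the function, and
    because a factorization of the derivative integrates to one of the function
    by the mean value inequality.  Neither contour integrals nor power series
    occur.

    The supremum over the open half plane is at least the one over the axis
    because [T] is continuous up to the axis ([hinf_norm_ge_axis]). *)

(** * The modulus of complex numbers *)

Section Modulus.
Context {R : realType}.
Implicit Types (z w : R[i]) (x y : R).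

Lemma normr_normc z : `|z| = (normc z)%:C.
Proof. by case: z. Qed.

Lemma normcD z w : normc (z + w) <= normc z + normc w.
Proof. exact: (@le_normcD R z w). Qed.

Lemma normcB z w : normc (z - w) = normc (w - z).
Proof. by rewrite -[RHS](@normcN R) opprB. Qed.

Lemma normc_ge0 z : 0 <= normc z.
Proof. by case: z => a b /=; exact: sqrtr_ge0. Qed.

Lemma normc_eq0 z : (normc z == 0) = (z == 0).
Proof.
by apply/eqP/eqP => [|->]; [exact: eq0_normc|exact: normc0].
Qed.

Lemma normc_gt0 z : (0 < normc z) = (z != 0).
Proof. by rewrite lt_def normc_ge0 andbT normc_eq0. Qed.

Lemma normcX z n : normc (z ^+ n) = normc z ^+ n.
Proof.
by elim: n => [|n IHn]; rewrite ?expr0 ?(@normc1 R) // !exprS normcM IHn.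
Qed.

Lemma normcC x : normc x%:C = `|x|.
Proof. by rewrite /= expr0n /= addr0 sqrtr_sqr. Qed.

Lemma normc_leB z w : normc z - normc (z - w) <= normc w.
Proof. by rewrite lerBlDr -{1}(subrK w z) addrC normcD. Qed.

Lemma Re_le_normc z : `|complex.Re z| <= normc z.
Proof.
case: z => a b /=; rewrite -sqrtr_sqr; apply: ler_wsqrtr.
by rewrite lerDl sqr_ge0.
Qed.

Lemma Im_le_normc z : `|complex.Im z| <= normc z.
Proof.
case: z => a b /=; rewrite -sqrtr_sqr; apply: ler_wsqrtr.
by rewrite lerDr sqr_ge0.
Qed.

Lemma normc_leD z : normc z <= `|complex.Re z| + `|complex.Im z|.
Proof.
case: z => a b; rewrite -[a +i* b]/(_ +i* _).
have -> : a +i* b = a%:C + 0 +i* b by simpc.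
apply: (le_trans (normcD _ _)); rewrite normcC /=.
by rewrite expr0n /= add0r sqrtr_sqr addr0 add0r.
Qed.

Lemma ReM z w : complex.Re (z * w) =
  complex.Re z * complex.Re w - complex.Im z * complex.Im w.
Proof. by case: z w => a b [c d]. Qed.

Lemma ImM z w : complex.Im (z * w) =
  complex.Re z * complex.Im w + complex.Im z * complex.Re w.
Proof. by case: z w => a b [c d]. Qed.

Lemma ReD z w : complex.Re (z + w) = complex.Re z + complex.Re w.
Proof. by case: z w => a b [c d]. Qed.

Lemma ImD z w : complex.Im (z + w) = complex.Im z + complex.Im w.
Proof. by case: z w => a b [c d]. Qed.

End Modulus.

(** * Continuity and regularization *)

(** Stated over an abstract [K] because the topology that [regularize] refers
    to is the one attached to a [numFieldType]; at [K = R[i]] the lemma [contP]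
    gives the usual description by real radii. *)
Definition cont (K : numFieldType) (f : K -> K) (s : K) : Prop :=
  {for s, continuous f}.

Section Continuity.
Local Open Scope classical_set_scope.
Variable K : numFieldType.
Implicit Types (f g : K -> K) (s : K).

Lemma contD f g s : cont f s -> cont g s -> cont (fun z => f z + g z) s.
Proof. by move=> cf cg; exact: continuousD. Qed.

Lemma contM f g s : cont f s -> cont g s -> cont (fun z => f z * g z) s.
Proof. by move=> cf cg; exact: continuousM. Qed.

Lemma contV f s : f s != 0 -> cont f s -> cont (fun z => (f z)^-1) s.
Proof. by move=> f0 cf; exact: continuousV. Qed.

Lemma cont_cst c s : cont (fun=> c) s.
Proof. exact: cst_continuous. Qed.

Lemma cont_id s : cont id s.
Proof. by move=> A; apply. Qed.

Lemma cont_horner (p : {poly K}) s : cont (horner p) s.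
Proof.
elim/poly_ind: p => [|p c cp].
  rewrite (_ : horner 0 = fun=> 0); first exact: cont_cst.
  by apply/funext => z; rewrite horner0.
rewrite (_ : horner _ = fun z => p.[z] * z + c); last first.
  by apply/funext => z; rewrite !hornerE.
exact: (contD (contM cp (@cont_id s)) (@cont_cst c s)).
Qed.

Lemma cont_eps f s : cont f s <->
  (forall e, 0 < e ->
   exists2 d, 0 < d & forall z, `|z - s| < d -> `|f z - f s| < e).
Proof.
split=> [cf e e0|H].
  have := (@cvgrPdist_lt K K K (nbhs s) (nbhs_filter s) f (f s)).1
    (cf : f @ s --> f s) e e0.
  case/nbhs_ballP => d d0 H.
  exists d => // z zd.
  by rewrite distrC; apply: H; rewrite /ball/= distrC.
apply/(@cvgrPdist_lt K K K (nbhs s) (nbhs_filter s) f (f s)) => e e0.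
have [d d0 H'] := H e e0.
apply/nbhs_ballP; exists d => // z; rewrite /ball/= => zd.
by rewrite distrC; apply: H'; rewrite distrC.
Qed.

(** Changing a function on a punctured neighbourhood does not change its
    regularization, so any continuous extension computes it. *)
Lemma regularize_eq f g s (d : K) : 0 < d -> cont g s ->
  (forall z, `|z - s| < d -> z != s -> f z = g z) -> regularize f s = g s.
Proof.
move=> d0 cg fg; rewrite /regularize.
apply/cvg_lim => //.
apply: cvg_trans (cvg_within_filter _ (cg : g @ s --> g s)).
apply: near_eq_cvg.
rewrite /dnbhs near_withinE.
apply/nbhs_ballP; exists d => // z; rewrite /ball/= => zd zs.
by rewrite fg // distrC.
Qed.

End Continuity.

Section ContinuityC.
Context {R : realType}.
Implicit Types (f g : R[i] -> R[i]) (s z : R[i]).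

Lemma gt0_complexP (e : R[i]) : 0 < e -> exists2 x : R, 0 < x & e = x%:C.
Proof.
case: e => a b; rewrite ltcE /= => /andP[/eqP -> a0].
by exists a.
Qed.

Lemma contP f s : cont f s <->
  (forall e : R, 0 < e -> exists2 d : R, 0 < d &
    forall z, normc (z - s) < d -> normc (f z - f s) < e).
Proof.
rewrite cont_eps; split=> [H e e0|H e /gt0_complexP[x x0 ->]].
  have [|d /gt0_complexP[x x0 ->] Hd] := H e%:C; first by rewrite ltcR.
  exists x => // z zx; move: (Hd z); rewrite !normr_normc !ltcR; exact.
have [d d0 Hd] := H x x0; exists d%:C; first by rewrite ltcR.
by move=> z; rewrite !normr_normc !ltcR; exact: Hd.
Qed.

Lemma regularizeC_eq f g s (d : R) : 0 < d -> cont g s ->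
  (forall z, normc (z - s) < d -> z != s -> f z = g z) ->
  regularize f s = g s.
Proof.
move=> d0 cg fg; apply: (@regularize_eq _ f g s d%:C) => //.
  by rewrite ltcR.
by move=> z; rewrite normr_normc ltcR; exact: fg.
Qed.

Lemma cont_neq0 f s : cont f s -> f s != 0 ->
  exists2 d : R, 0 < d & forall z, normc (z - s) < d -> f z != 0.
Proof.
move=> /contP cf f0.
have [|d d0 Hd] := cf (normc (f s)); first by rewrite normc_gt0.
exists d => // z /Hd; apply: contraTneq => ->.
by rewrite sub0r (@normcN R) ltxx.
Qed.

End ContinuityC.
(** * Complex derivatives along real lines *)

Section ComplexDerivative.
Context {R : realType}.
Implicit Types (f g df dg : R[i] -> R[i]) (s h z c : R[i]).
Local Notation Re := complex.Re.
Local Notation Im := complex.Im.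

(** Complex differentiability read on the restrictions to real lines: the real
    and imaginary parts of [f] along [s + u h] have the derivatives that the
    chain rule predicts from [df].  This reduces the calculus rules and the mean
    value inequality to those of functions of one real variable. *)
Definition has_deriv f df := forall s h (t : R),
  is_derive t 1 (fun u : R => Re (f (s + u%:C * h)))
    (Re (h * df (s + t%:C * h)))
  /\
  is_derive t 1 (fun u : R => Im (f (s + u%:C * h)))
    (Im (h * df (s + t%:C * h))).

Lemma has_deriv_cst c : has_deriv (fun=> c) (fun=> 0).
Proof. by move=> s h t; rewrite mulr0 /=; split; exact: is_derive_cst. Qed.

Lemma has_deriv_id : has_deriv id (fun=> 1).
Proof.
move=> s h t; rewrite mulr1 /=; split.
- rewrite (_ : (fun u => _) = cst (Re s) + (id : R -> R) * cst (Re h));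
    last first.
    by apply/funext => u; rewrite ReD ReM /= mul0r subr0.
  apply: is_derive_eq; rewrite /GRing.scale /=; ring.
- rewrite (_ : (fun u => _) = cst (Im s) + (id : R -> R) * cst (Im h));
    last first.
    by apply/funext => u; rewrite ImD ImM /= mul0r addr0.
  apply: is_derive_eq; rewrite /GRing.scale /=; ring.
Qed.

Lemma has_derivD f df g dg : has_deriv f df -> has_deriv g dg ->
  has_deriv (fun z => f z + g z) (fun z => df z + dg z).
Proof.
move=> Df Dg s h t; have [fr fi] := Df s h t; have [gr gi] := Dg s h t.
rewrite mulrDr ReD ImD; split.
- rewrite (_ : (fun u => _) = (fun u : R => Re (f (s + u%:C * h))) +
    (fun u : R => Re (g (s + u%:C * h)))); first exact: is_deriveD.
  by apply/funext => u; rewrite ReD.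
- rewrite (_ : (fun u => _) = (fun u : R => Im (f (s + u%:C * h))) +
    (fun u : R => Im (g (s + u%:C * h)))); first exact: is_deriveD.
  by apply/funext => u; rewrite ImD.
Qed.

Lemma has_derivM f df g dg : has_deriv f df -> has_deriv g dg ->
  has_deriv (fun z => f z * g z) (fun z => df z * g z + f z * dg z).
Proof.
move=> Df Dg s h t; have [fr fi] := Df s h t; have [gr gi] := Dg s h t.
split.
- rewrite (_ : (fun u => _) = (fun u : R => Re (f (s + u%:C * h))) *
    (fun u : R => Re (g (s + u%:C * h))) -
    (fun u : R => Im (f (s + u%:C * h))) *
    (fun u : R => Im (g (s + u%:C * h)))); last first.
    by apply/funext => u; rewrite ReM.
  apply: is_derive_eq; rewrite /GRing.scale /= !(ReM, ImM, ReD, ImD); ring.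
- rewrite (_ : (fun u => _) = (fun u : R => Re (f (s + u%:C * h))) *
    (fun u : R => Im (g (s + u%:C * h))) +
    (fun u : R => Im (f (s + u%:C * h))) *
    (fun u : R => Re (g (s + u%:C * h)))); last first.
    by apply/funext => u; rewrite ImM.
  apply: is_derive_eq; rewrite /GRing.scale /= !(ReM, ImM, ReD, ImD); ring.
Qed.

Lemma has_deriv_ext f g df dg : f =1 g -> df =1 dg ->
  has_deriv f df -> has_deriv g dg.
Proof. by move=> /funext -> /funext ->. Qed.

Lemma has_deriv_horner (p : {poly R[i]}) : has_deriv (horner p) (horner p^`()).
Proof.
elim/poly_ind: p => [|p c IHp].
  apply: (has_deriv_ext _ _ (has_deriv_cst 0)) => z; by rewrite ?derivC horner0.
apply: (has_deriv_ext _ _ (has_derivD (has_derivM IHp has_deriv_id)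
  (has_deriv_cst c))) => z; rewrite /= ?mulr1 ?addr0
  ?derivD ?derivM ?derivC ?derivX ?hornerE //.
Qed.

Lemma has_deriv_cexp c :
  has_deriv (fun z => cexp (c * z)) (fun z => c * cexp (c * z)).
Proof.
move=> s h t.
have [] := has_derivM (has_deriv_cst c) has_deriv_id s h t.
rewrite mul0r add0r mulr1 => lr li.
have er := is_derive1_comp (is_derive_expR _) lr.
have ec := is_derive1_comp (is_derive_cos _) li.
have es := is_derive1_comp (is_derive_sin _) li.
split.
- rewrite (_ : (fun u => _) = (expR \o (fun u : R => Re (c * (s + u%:C * h)))) *
   (cos \o (fun u : R => Im (c * (s + u%:C * h))))) //.
  apply: is_derive_eq; rewrite /GRing.scale /=.
  by move: (c * _) => w; rewrite !(ReM, ImM) /=; ring.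
- rewrite (_ : (fun u => _) = (expR \o (fun u : R => Re (c * (s + u%:C * h)))) *
   (sin \o (fun u : R => Im (c * (s + u%:C * h))))) //.
  apply: is_derive_eq; rewrite /GRing.scale /=.
  by move: (c * _) => w; rewrite !(ReM, ImM) /=; ring.
Qed.

(** The mean value theorem holds for the real and the imaginary part
    separately, whence the factor 2; the sharp constant 1 is not worth a
    rotation here, as the bound is only used in limits. *)
Lemma mean_value f df s h (K : R) : has_deriv f df ->
  (forall t : R, 0 <= t <= 1 -> normc (df (s + t%:C * h)) <= K) ->
  normc (f (s + h) - f s) <= 2 * K * normc h.
Proof.
move=> Df dfK.
have part (u du : R -> R) : (forall t, is_derive t (1:R) u (du t)) ->
    (forall t, 0 <= t <= 1 -> `|du t| <= K * normc h) ->
    `|u 1 - u 0| <= K * normc h.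
  move=> Du duK.
  have [|t] := @MVT_segment R u du 0 1 ler01.
    apply: continuous_subspaceT => t; apply: differentiable_continuous.
    by apply/derivable1_diffP; have [] := Du t.
  by rewrite in_itv /= => t01 ->; rewrite subr0 mulr1; exact: duK.
have dK t : 0 <= t <= 1 -> normc (h * df (s + t%:C * h)) <= K * normc h.
  by move=> t01; rewrite normcM mulrC ler_wpM2r ?normc_ge0 ?dfK.
have := part _ _ (fun t => (Df s h t).1)
  (fun t t01 => le_trans (Re_le_normc _) (dK t t01)).
have := part _ _ (fun t => (Df s h t).2)
  (fun t t01 => le_trans (Im_le_normc _) (dK t t01)).
rewrite /= rmorph1 mul1r rmorph0 mul0r addr0 => i r.
apply: le_trans (normc_leD _) _.
rewrite -mulrA mulr_natl mulr2n; apply: lerD.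
  by rewrite -raddfB in r.
by rewrite -raddfB in i.
Qed.

Lemma normc_cexp z : normc (cexp z) = expR (Re z).
Proof.
rewrite /cexp /= !exprMn -mulrDr cos2Dsin2 mulr1 sqrtr_sqr.
by rewrite ger0_norm ?expR_ge0.
Qed.

Lemma cont_cexp c s : cont (fun z => cexp (c * z)) s.
Proof.
apply/contP => e e0.
(* [K] bounds the derivative on the disk of radius 1 around [s]. *)
pose K := normc c * expR (Re (c * s) + normc c).
have K0 : 0 <= K by rewrite mulr_ge0 ?normc_ge0 ?expR_ge0.
exists (Num.min 1 (e / (2 * K + 1))) => [|z].
  by rewrite lt_min ltr01 divr_gt0 // ltr_pwDr // mulr_ge0.
rewrite lt_min => /andP[z1 ze].
rewrite -{1}(subrKC s z).
apply: le_lt_trans (mean_value (K := K) (@has_deriv_cexp c) _) _.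
  move=> t /andP[t0 t1]; rewrite normcM normc_cexp ler_wpM2l ?normc_ge0 //.
  rewrite ler_expR mulrDr ReD lerD2l (le_trans (ler_norm _)) //.
  rewrite (le_trans (Re_le_normc _)) // mulrCA !normcM normcC ger0_norm //.
  rewrite mulrCA ler_piMr ?normc_ge0 // mulr_ile1 ?normc_ge0 //.
  exact: ltW.
have K2 : 0 < 2 * K + 1 by rewrite ltr_pwDr // mulr_ge0.
rewrite (@le_lt_trans _ _ ((2 * K + 1) * normc (z - s))) //.
  by rewrite ler_wpM2r ?normc_ge0 // lerDl.
by rewrite mulrC -ltr_pdivlMr.
Qed.

End ComplexDerivative.
(** * Local factorization of exponential polynomials *)

Section LocalFactorization.
Context {R : realType}.
Implicit Types (f df : R[i] -> R[i]) (s z c : R[i]) (A B : {poly R[i]}).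

Definition factors_at f s := exists n (F : R[i] -> R[i]),
  [/\ F s != 0, cont F s & forall z, f z = (z - s) ^+ n * F z].

(** With [df z = (z - s)^n F(z)] and [a = F(s) / (n + 1)], the function
    [f z - a (z - s)^(n+1)] has derivative [(z - s)^n (F z - F s)], which is
    [o((z - s)^n)]; the mean value inequality turns this into
    [f z = (z - s)^(n+1) (a + o(1))]. *)
Lemma factors_at_primitive f df s : has_deriv f df -> f s = 0 ->
  factors_at df s -> factors_at f s.
Proof.
move=> Df fs0 [n [F [Fs0 cF dfE]]].
have n0 : n.+1%:R != 0 :> R[i] by rewrite pnatr_eq0.
pose a := F s / n.+1%:R.
pose F1 z := if z == s then a else f z / (z - s) ^+ n.+1.
exists n.+1, F1; split.
- by rewrite /F1 eqxx mulf_neq0 ?invr_neq0.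
- apply/contP => e e0.
  (* 3 beats the factor 2 of [mean_value] *)
  have [|d d0 Fd] := (contP F s).1 cF (e / 3); first by rewrite divr_gt0.
  exists d => // z zd; rewrite {2}/F1 eqxx /F1.
  case: eqVneq => [_|zs]; first by rewrite subrr normc0.
  have zs0 : z - s != 0 by rewrite subr_eq0.
  pose p := (- a) *: ('X - s%:P) ^+ n.+1.
  have Dg := has_derivD Df (has_deriv_horner p).
  have := mean_value (s := s) (h := z - s)
    (K := normc (z - s) ^+ n * (e / 3)) Dg.
  have pE w : p.[w] = - a * (w - s) ^+ n.+1.
    by rewrite hornerZ horner_exp hornerXsubC.
  have dpE w : p^`().[w] = - a * (n.+1%:R * (w - s) ^+ n).
    rewrite derivZ hornerZ deriv_exp derivXsubC mul1r hornerMn horner_exp.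
    by rewrite hornerXsubC mulr_natl.
  rewrite /= fs0 subrKC !pE subrr expr0n mulr0 addr0 subr0 => mv.
  have -> : f z / (z - s) ^+ n.+1 - a =
            (f z - a * (z - s) ^+ n.+1) / (z - s) ^+ n.+1.
    by rewrite mulrBl mulfK // expf_neq0.
  rewrite normcM normcV normcX ltr_pdivrMr ?exprn_gt0 ?normc_gt0 //.
  rewrite -mulNr.
  apply: le_lt_trans (mv _) _.
    move=> t /andP[t0 t1].
    have tz : normc (t%:C * (z - s)) <= normc (z - s).
      by rewrite normcM normcC ger0_norm // ler_piMl ?normc_ge0.
    rewrite dfE dpE [s + _ - s]addrAC subrr add0r.
    have -> : (t%:C * (z - s)) ^+ n * F (s + t%:C * (z - s)) +
        (- a) * (n.+1%:R * (t%:C * (z - s)) ^+ n) =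
        (t%:C * (z - s)) ^+ n * (F (s + t%:C * (z - s)) - F s).
      by rewrite mulNr [a * _]mulrA divfK // [RHS]mulrBr [F s * _]mulrC.
    rewrite normcM normcX ler_pM ?exprn_ge0 ?normc_ge0 //.
      by rewrite lerXn2r ?nnegrE ?normc_ge0.
    apply/ltW/Fd; rewrite addrAC subrr add0r.
    exact: le_lt_trans zd.
  have N0 : 0 < normc (z - s) ^+ n.+1 by rewrite exprn_gt0 ?normc_gt0.
  rewrite [X in X < _](_ : _ = normc (z - s) ^+ n.+1 * (2 / 3 * e)).
    rewrite [ltRHS]mulrC ltr_pM2l //; lra.
  by rewrite exprS; field.
- move=> z; rewrite /F1; case: eqVneq => [->|zs].
    by rewrite fs0 subrr expr0n mul0r.
  by rewrite mulrC divfK // expf_neq0 // subr_eq0.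
Qed.

Definition epoly c A B z := A.[z] + B.[z] * cexp (c * z).

Lemma has_deriv_epoly c A B :
  has_deriv (epoly c A B) (epoly c A^`() (B^`() + c *: B)).
Proof.
apply: (has_deriv_ext _ _ (has_derivD (has_deriv_horner A)
  (has_derivM (has_deriv_horner B) (has_deriv_cexp c)))) => // z.
by rewrite /epoly hornerD hornerZ; ring.
Qed.

Lemma cont_epoly c A B s : cont (epoly c A B) s.
Proof.
exact: (contD (@cont_horner _ A s)
  (contM (@cont_horner _ B s) (@cont_cexp _ c s))).
Qed.

Lemma cexp_neq0 z : cexp z != 0.
Proof. by rewrite -normc_gt0 normc_cexp expR_gt0. Qed.

(** Induction on the size of [A].  For [A = 0] the exponential factor has no
    zeros and the order is the multiplicity of a root of [B].  Otherwise, if the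
    function vanishes at [s], it is recovered from its derivative, which has the
    same form with a smaller polynomial part. *)
Lemma epoly_factors_at c A B s :
  (forall z, epoly c A B z = 0) \/ factors_at (epoly c A B) s.
Proof.
have [m] := ubnP (size A); elim: m A B => // m IHm A B.
rewrite ltnS => sA.
have [A0|A0] := eqVneq A 0.
  have [B0|B0] := eqVneq B 0.
    by left=> z; rewrite /epoly A0 B0 !horner0 mul0r addr0.
  right; have [n [Q]] := multiplicity_XsubC B s; rewrite B0 /= => Qs BE.
  exists n, (fun z => Q.[z] * cexp (c * z)); split.
  - by rewrite mulf_neq0 ?cexp_neq0.
  - exact: contM (@cont_horner _ Q s) (@cont_cexp _ c s).
  - move=> z; rewrite /epoly A0 BE horner0 add0r hornerM horner_exp hornerXsubC.
    by rewrite mulrA [Q.[z] * _]mulrC.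
have [fs0|fs0] := eqVneq (epoly c A B s) 0; last first.
  right; exists 0%N, (epoly c A B); split => // [|z]; first exact: cont_epoly.
  by rewrite expr0 mul1r.
have Df := has_deriv_epoly c A B.
have [|d0|dF] := IHm A^`() (B^`() + c *: B).
- exact: leq_trans (lt_size_deriv A0) sA.
- left=> z; apply/eqP; rewrite -normc_eq0 eq_le normc_ge0 andbT.
  have := mean_value (s := s) (h := z - s) (K := 0) Df.
  rewrite subrKC fs0 subr0 mulr0 mul0r; apply=> t _.
  by rewrite d0 normc0.
- by right; apply: factors_at_primitive Df fs0 dF.
Qed.

Lemma factors_at_neq0 f s : factors_at f s ->
  exists2 d : R, 0 < d & forall z, normc (z - s) < d -> z != s -> f z != 0.
Proof.
move=> [n [F [F0 cF fE]]]; have [d d0 Fd] := cont_neq0 cF F0.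
exists d => // z zd zs; rewrite fE mulf_neq0 ?Fd //.
by rewrite expf_neq0 // subr_eq0.
Qed.

End LocalFactorization.
(** * Growth of polynomials at infinity *)

Section Growth.
Context {R : realType}.
Implicit Types (z : R[i]) (p a b : {poly R[i]}).

Lemma normc_sum n (F : 'I_n -> R[i]) :
  normc (\sum_i F i) <= \sum_i normc (F i).
Proof.
elim/big_ind2: _ => [|x u y v xu yv|//]; first by rewrite (@normc0 R).
exact: le_trans (normcD _ _) (lerD xu yv).
Qed.

(** The factor [normc z] on the left keeps the exponent [m], which makes
    the case [m = 0], [p = 0] uniform with the others. *)
Lemma horner_upper p m : (size p <= m)%N -> exists2 K : R, 0 <= K &
  forall z, 1 <= normc z -> normc p.[z] * normc z <= K * normc z ^+ m.
Proof.
move=> pm; exists (\sum_(i < m) normc p`_i).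
  by apply: sumr_ge0 => i _; exact: normc_ge0.
move=> z z1; rewrite (horner_coef_wide _ pm).
apply: le_trans (ler_wpM2r (normc_ge0 _) (normc_sum _)) _.
rewrite mulr_suml mulr_suml; apply: ler_sum => i _.
rewrite normcM normcX -mulrA ler_wpM2l ?normc_ge0 // -exprSr.
exact: ler_weXn2l.
Qed.

Lemma horner_lower p m : size p = m.+1 -> exists2 c : R, 0 < c &
  exists r : R, forall z, r <= normc z -> c * normc z ^+ m <= normc p.[z].
Proof.
move=> pm; set L := normc (lead_coef p).
have L0 : 0 < L by rewrite normc_gt0 lead_coef_eq0 -size_poly_eq0 pm.
pose q := p - lead_coef p *: 'X^m.
have qm : (size q <= m)%N.
  apply/leq_sizeP => j; rewrite leq_eqVlt => /orP[/eqP <-|mj].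
    by rewrite coefB coefZ coefXn eqxx mulr1 lead_coefE pm subrr.
  rewrite coefB coefZ coefXn gtn_eqF // mulr0 subr0.
  by move/leq_sizeP: (leqnn (size p)); apply; rewrite pm.
have [K K0 qK] := horner_upper qm.
exists (L / 2); first by rewrite divr_gt0.
exists (Num.max 1 (2 * K / L)) => z; rewrite ge_max => /andP[z1 zK].
have z0 : 0 < normc z by exact: lt_le_trans z1.
have -> : p.[z] = lead_coef p * z ^+ m - (- q.[z]).
  by rewrite opprK /q hornerD hornerN hornerZ hornerXn subrKC.
have := normcD (lead_coef p * z ^+ m - - q.[z]) (- q.[z]).
rewrite subrK (@normcN R) normcM normcX -/L => h.
have qz : normc q.[z] <= L / 2 * normc z ^+ m.
  rewrite -(ler_pM2r z0) (le_trans (qK _ z1)) //.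
  rewrite mulrAC ler_wpM2r ?exprn_ge0 ?normc_ge0 //.
  move: zK; rewrite ler_pdivrMr //; lra.
lra.
Qed.

Lemma horner_dominated a b : (size a < size b)%N -> forall e : R, 0 < e ->
  exists r : R, forall z, r <= normc z ->
    b.[z] != 0 /\ normc a.[z] <= e * normc b.[z].
Proof.
case sb : (size b) => [//|m]; rewrite ltnS => am e e0.
have [K K0 aK] := horner_upper am.
have [c c0 [r br]] := horner_lower sb.
exists (Num.max r (Num.max 1 (K / (c * e)))) => z.
rewrite !ge_max => /and3P[zr z1 zK].
have z0 : 0 < normc z by exact: lt_le_trans z1.
have bz := br _ zr.
have zm : 0 < c * normc z ^+ m by rewrite mulr_gt0 ?exprn_gt0.
split; first by rewrite -normc_gt0 (lt_le_trans zm).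
rewrite -(ler_pM2r z0) (le_trans (aK _ z1)) //.
move: zK; rewrite ler_pdivrMr ?mulr_gt0 // => zK.
apply: (@le_trans _ _ (e * normc z * (c * normc z ^+ m))).
  have -> : e * normc z * (c * normc z ^+ m) =
    normc z * (c * e) * normc z ^+ m by ring.
  by rewrite ler_wpM2r ?exprn_ge0 ?normc_ge0.
by rewrite mulrAC ler_wpM2r ?normc_ge0 // ler_wpM2l // ltW.
Qed.

End Growth.

(** * The maximum principle in the right half plane *)

Section MaximumPrinciple.
Context {R : realType}.
Implicit Types (f F : R[i] -> R[i]) (s z c : R[i]) (A B : {poly R[i]}).
Local Notation Re := complex.Re.
Local Notation Im := complex.Im.

(** Along [z = s + t w] with [w^n = f(s) / F(s)] and [t > 0], one has
    [f(z) = f(s) (1 + t^n H(z))] where [H = F / F(s)] is close to 1, so the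
    modulus grows. *)
Lemma not_local_max f F s n (d : R) : 0 < d -> f s != 0 -> F s != 0 ->
  cont F s -> (0 < n)%N ->
  (forall z, normc (z - s) < d -> f z = f s + (z - s) ^+ n * F z) ->
  exists2 z, normc (z - s) < d & normc (f s) < normc (f z).
Proof.
move=> d0 fs0 Fs0 cF n0 fE.
pose H z := F z / F s.
have cH : cont H s by exact: (contM cF (@cont_cst _ (F s)^-1 s)).
have [|r r0 Hr] := (contP H s).1 cH 1; first exact: ltr01.
pose w := (n.-root (f s / F s))%C.
have wn : w ^+ n = f s / F s by rewrite rootCK.
have w0 : 0 < normc w.
  have : w ^+ n != 0 by rewrite wn mulf_neq0 ?invr_neq0.
  by rewrite normc_gt0 expf_eq0 n0.
pose t := Num.min d r / (2 * normc w).
have dr0 : 0 < Num.min d r by rewrite lt_min d0.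
have t0 : 0 < t by rewrite divr_gt0 // mulr_gt0.
pose z := s + t%:C * w.
have zs : z - s = t%:C * w by rewrite /z addrAC subrr add0r.
have : normc (z - s) < Num.min d r.
  rewrite zs normcM normcC gtr0_norm // /t.
  have -> : Num.min d r / (2 * normc w) * normc w = Num.min d r / 2.
    by field; rewrite gt_eqF.
  by rewrite ltr_pdivrMr // mulr_natr mulr2n ltrDl.
rewrite lt_min => /andP[zd zr].
exists z => //; rewrite (fE z) // zs exprMn wn.
have -> : f s + t%:C ^+ n * (f s / F s) * F z = f s * (1 + t%:C ^+ n * H z).
  by rewrite /H; ring.
rewrite normcM ltr_pMr ?normc_gt0 //.
apply: lt_le_trans (le_trans (ler_norm _) (Re_le_normc _)).
rewrite ReD ltrDl -rmorphXn ReM /= mul0r subr0 mulr_gt0 ?exprn_gt0 //.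
have := le_lt_trans (Re_le_normc _) (Hr _ zr).
rewrite {2}/H divff // ReD /= ltr_norml => /andP[].
by rewrite -subr_gt0 opprK subrK.
Qed.

Local Open Scope classical_set_scope.

Lemma box_max f (r : R) : 0 <= r -> (forall z, 0 <= Re z -> cont f z) ->
  exists2 s, 0 <= Re s & forall z, 0 <= Re z -> Re z <= r -> `|Im z| <= r ->
    normc (f z) <= normc (f s).
Proof.
move=> r0 cf.
pose box : set (R * R) := `[0, r] `*` `[- r, r].
pose g (u : R * R) := normc (f (u.1 +i* u.2)).
have cbox : compact box by apply: compact_setX; exact: segment_compact.
have box0 : box !=set0.
  by exists (0, 0); split; rewrite /= in_itv /= ?lexx ?r0 // oppr_le0 r0.
have cg : {within box, continuous g}.
  apply: continuous_in_subspaceT => -[x y].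
  rewrite inE => -[/= /[!in_itv]/= /andP[x0 _] _].
  apply/(@cvgrPdist_lt R R (R * R)%type (nbhs (x, y)) _ g (g (x, y))) => e e0.
  have [d d0 Hd] := (contP f (x +i* y)).1 (cf (x +i* y) x0) e e0.
  apply/nbhs_ballP; exists (d / 2); first by rewrite /= divr_gt0.
  move=> [x' y'] [/= xx yy]; rewrite /g /=.
  have /Hd fd : normc ((x' +i* y') - (x +i* y)) < d.
    apply: le_lt_trans (normc_leD _) _; rewrite /= [d]splitr.
    by apply: ltrD; rewrite distrC; [exact: xx|exact: yy].
  apply: le_lt_trans fd; rewrite ler_norml; apply/andP; split.
    rewrite lerNl opprB lerBlDr; apply: le_trans (normcD _ _).
    by rewrite subrK.
  rewrite lerBlDr normcB; apply: le_trans (normcD _ _).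
  by rewrite subrK.
have [[x y] /[!inE] -[/= /[!in_itv]/= /andP[x0 _] _] gmax] :=
  compact_EVT_max box0 cbox cg.
exists (x +i* y) => // -[x' y'] /= x'0 x'r y'r.
apply: (gmax (x', y')); rewrite inE; split; rewrite /= in_itv /=.
  by rewrite x'0.
by rewrite -ler_norml.
Qed.

(** The decay at infinity confines the search for a maximum to a bounded box.
    An interior maximum [s] is excluded by [not_local_max], applied to the
    factorization of the numerator of [f - f(s)]; should this numerator vanish
    identically, [f] would be a non-zero constant, against the decay. *)
Lemma max_on_axis c A1 B1 A2 B2 s0
    (f := fun z => epoly c A1 B1 z / epoly c A2 B2 z) :
  (forall z, 0 <= Re z -> epoly c A2 B2 z != 0) ->
  (forall e : R, 0 < e -> exists r : R, forall z, 0 <= Re z ->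
     r <= normc z -> normc (f z) < e) ->
  0 <= Re s0 -> f s0 != 0 ->
  exists w : R, forall z, 0 <= Re z -> normc (f z) <= normc (f (0 +i* w)).
Proof.
move=> D0 f0 s00 fs0.
have cf z : 0 <= Re z -> cont f z.
  move=> z0; apply: (contM (@cont_epoly _ c A1 B1 z)).
  exact: (contV (D0 z z0) (@cont_epoly _ c A2 B2 z)).
have [|r0 fr0] := f0 (normc (f s0)); first by rewrite normc_gt0.
pose r := Num.max 0 r0.
have r_ge0 : 0 <= r by rewrite le_max lexx.
have fr z : 0 <= Re z -> r <= normc z -> normc (f z) < normc (f s0).
  move=> z0 rz; apply: fr0 => //; apply: le_trans rz.
  by rewrite le_max lexx orbT.
have [s s_ge0 smax'] := box_max r_ge0 cf.
have smax z : 0 <= Re z -> normc z < r -> normc (f z) <= normc (f s).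
  move=> z0 zr; apply: smax' => //.
    exact: le_trans (le_trans (ler_norm _) (Re_le_normc _)) (ltW zr).
  exact: le_trans (Im_le_normc _) (ltW zr).
have s0s : normc (f s0) <= normc (f s).
  apply: smax => //; rewrite ltNge; apply/negP => /fr.
  by rewrite ltxx => /(_ s00).
have {}smax z : 0 <= Re z -> normc (f z) <= normc (f s).
  move=> z0; case: (ltP (normc z) r) => [/smax|/fr]; first exact.
  by move=> /(_ z0) /ltW zs; exact: le_trans zs s0s.
have fs : f s != 0 by rewrite -normc_gt0 (lt_le_trans _ s0s) ?normc_gt0.
have [s_gt0|] := ltP 0 (Re s); last first.
  move=> s_le0; exists (Im s); suff -> : 0 +i* Im s = s by [].
  by apply/eqP; rewrite eq_complex /= eqxx andbT eq_le s_ge0.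
(* the numerator of [f - f s] *)
pose h := epoly c (A1 - f s *: A2) (B1 - f s *: B2).
have hE z : h z = epoly c A1 B1 z - f s * epoly c A2 B2 z.
  by rewrite /h /epoly !hornerD !hornerN !hornerZ; ring.
have fE z : epoly c A2 B2 z != 0 -> f z = f s + h z / epoly c A2 B2 z.
  by move=> Dz; rewrite hE mulrBl mulfK // addrC subrK.
have [h0|[n [F [Fs cF hF]]]] := epoly_factors_at c (A1 - f s *: A2)
  (B1 - f s *: B2) s.
  have [|r1 fr1] := f0 (normc (f s)); first by rewrite normc_gt0.
  pose x := Num.max 0 r1.
  have x0 : 0 <= x by rewrite le_max lexx.
  have := fr1 x%:C x0; rewrite fE ?D0 // /h h0 mul0r addr0 ltxx.
  by rewrite normcC ger0_norm // le_max lexx orbT => /(_ isT).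
have n0 : (0 < n)%N.
  rewrite lt0n; apply: contra_neq Fs => n0.
  have := hF s; rewrite -/(h s) hE /f divfK ?D0 // subrr n0 expr0 mul1r.
  by move=> <-.
have [d d0 Dd] := cont_neq0 (@cont_epoly _ c A2 B2 s) (D0 s s_ge0).
have [|||||z] := @not_local_max f (fun z => F z / epoly c A2 B2 z) s n
  (Num.min d (Re s)) _ fs.
- by rewrite lt_min d0.
- by rewrite mulf_neq0 ?invr_neq0 ?D0.
- exact: (contM cF (contV (D0 s s_ge0) (@cont_epoly _ c A2 B2 s))).
- exact: n0.
- move=> z; rewrite lt_min => /andP[zd _].
  by rewrite fE ?Dd // /h hF mulrA.
rewrite lt_min => /andP[_ zs]; rewrite ltNge smax //.
have := le_lt_trans (Re_le_normc _) zs; rewrite raddfB ltr_norml => /andP[].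
by rewrite /= -subr_gt0 opprK subrK => /ltW.
Qed.

End MaximumPrinciple.
(** * The closed loop *)

Section ClosedLoop.
Context {R : realType}.
Local Notation Re := complex.Re.
Local Notation Im := complex.Im.
Implicit Types (s z : R[i]).

(** The roots of [E] are the finitely many points at which [P] and [C] need not
    be given by their quotients, because of division by zero or because the
    values of [C] are arbitrary there. *)
Variables (P C : R[i] -> R[i]) (tau : R) (nP dP nC dC E : {poly R[i]}).
Hypothesis tau_ge0 : 0 <= tau.
Hypothesis loopE : forall z, E.[z] != 0 ->
  [/\ dP.[z] != 0, dC.[z] != 0, P z = nP.[z] / dP.[z] & C z = nC.[z] / dC.[z]].
Hypothesis E_neq0 : E != 0.
Hypothesis loop_proper : (size (nP * nC)%R < size (dP * dC)%R)%N.

Local Notation delay := (- tau%:C).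

Definition charfun := epoly delay (dP * dC) (nP * nC).

Let charfunE z : charfun z =
  dP.[z] * dC.[z] + nP.[z] * nC.[z] * cexp (delay * z).
Proof. by rewrite /charfun /epoly !hornerM. Qed.

Lemma normc_delay z : normc (cexp (delay * z)) = expR (- tau * Re z).
Proof. by rewrite normc_cexp ReM /= oppr0 mul0r subr0. Qed.

(** The loop gain is strictly proper and the delay has modulus at most 1 in the
    half plane, so [dP dC] dominates the characteristic function far out. *)
Lemma charfun_lower : exists r : R, forall z, 0 <= Re z -> r <= normc z ->
  charfun z != 0 /\ normc (dP * dC).[z] <= 2 * normc (charfun z).
Proof.
have [|r Hr] := horner_dominated loop_proper (e := 1 / 2).
  by rewrite divr_gt0.
exists r => z z0 /Hr[Dz Nz].
have small : normc ((nP * nC).[z] * cexp (delay * z)) <=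
    1 / 2 * normc (dP * dC).[z].
  rewrite normcM normc_delay; apply: le_trans Nz.
  by rewrite ler_piMr ?normc_ge0 // -expR0 ler_expR mulNr oppr_le0 mulr_ge0.
have D0 : 0 < normc (dP * dC).[z] by rewrite normc_gt0.
have := normcD (charfun z) (- ((nP * nC).[z] * cexp (delay * z))).
rewrite (@normcN R) {1}/charfun /epoly addrK => h.
have h' : normc (dP * dC).[z] <= 2 * normc (charfun z) by rewrite /charfun; lra.
split=> //; rewrite -normc_gt0; lra.
Qed.

(** The product of [E] and the characteristic function is again an exponential
    polynomial; it is not identically zero by [charfun_lower], so its zeros are
    isolated. *)
Lemma generic_near s : exists2 d : R, 0 < d & forall z, normc (z - s) < d ->
  z != s -> E.[z] != 0 /\ charfun z != 0.
Proof.
pose W := epoly delay (E * (dP * dC)) (E * (nP * nC)).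
have WE z : W z = E.[z] * charfun z.
  by rewrite /W /charfun /epoly !hornerM; ring.
have [W0|/factors_at_neq0[d d0 Wd]] :=
    epoly_factors_at delay (E * (dP * dC)) (E * (nP * nC)) s; last first.
  exists d => // z zd zs; have := Wd z zd zs; rewrite -/W WE mulf_eq0 negb_or.
  by move/andP.
have [r Hr] := charfun_lower.
have [|r' Hr'] := @horner_dominated R 0 E _ 1 ltr01.
  by rewrite size_poly0 size_poly_gt0.
pose x := Num.max 0 (Num.max r r').
have x0 : 0 <= x by rewrite le_max lexx.
have [] := Hr x%:C x0.
  by rewrite normcC ger0_norm // !le_max lexx orbT.
have [] := Hr' x%:C.
  by rewrite normcC ger0_norm // !le_max lexx !orbT.
move=> Ex _ Dx _; have := W0 x%:C; rewrite -/W WE => /eqP.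
by rewrite mulf_eq0 (negbTE Ex) (negbTE Dx).
Qed.

Definition quotient_of_charfun (f X : R[i] -> R[i]) :=
  (forall s, cont X s) /\
  forall z, E.[z] != 0 -> charfun z != 0 -> f z = X z / charfun z.

Lemma regularize_quotient f X s : quotient_of_charfun f X -> charfun s != 0 ->
  regularize f s = X s / charfun s.
Proof.
move=> [cX fX] Ds; have [d d0 Wd] := generic_near s.
apply: (regularizeC_eq (g := fun z => X z / charfun z) d0).
  exact: (contM (cX s) (contV Ds (@cont_epoly _ _ _ _ s))).
by move=> z zd zs; have [Ez Dz] := Wd z zd zs; exact: fX.
Qed.

(** If [X s] were non-zero, [f = X / charfun] would be unbounded on the points
    [s + t] with small [t > 0], which lie in the open half plane even when [s]
    is on the imaginary axis. *)
Lemma stable_quotient_eq0 f X s : quotient_of_charfun f X -> stable f ->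
  0 <= Re s -> charfun s = 0 -> X s = 0.
Proof.
move=> fX [_ [B HB]] s0 Ds; apply/eqP; apply: contraT => Xs.
have Xs0 : 0 < normc (X s) by rewrite normc_gt0.
have [cX _] := fX.
pose b := `|B| + 1.
have b0 : 0 < b by rewrite ltr_wpDl.
have [d1 d10 Hd1] := generic_near s.
have [|d2 d20 Hd2] := (contP X s).1 (cX s) (normc (X s) / 2).
  by rewrite divr_gt0.
have [|d3 d30 Hd3] := (contP charfun s).1 (@cont_epoly _ _ _ _ s)
  (normc (X s) / (2 * b)).
  by rewrite divr_gt0 // mulr_gt0.
pose t := Num.min d1 (Num.min d2 d3) / 2.
have m0 : 0 < Num.min d1 (Num.min d2 d3) by rewrite !lt_min d10 d20.
have t0 : 0 < t by rewrite divr_gt0.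
have : t < Num.min d1 (Num.min d2 d3) by rewrite ltr_pdivrMr //; lra.
have zs : normc (s + t%:C - s) = t.
  by rewrite addrAC subrr add0r normcC gtr0_norm.
rewrite -zs !lt_min => /and3P[/Hd1 h1 /Hd2 h2 /Hd3 h3].
have [|_ Dz] := h1.
  by rewrite -subr_eq0 -normc_eq0 zs gt_eqF.
have zrhp : open_rhp (s + t%:C) by rewrite /open_rhp /= ReD ltr_wpDl.
have := HB _ zrhp; rewrite (regularize_quotient fX Dz) normcM normcV.
rewrite ler_pdivrMr ?normc_gt0 // => XB.
move: h3; rewrite Ds subr0 ltr_pdivlMr ?mulr_gt0 // => h3.
have h4 : B * normc (charfun (s + t%:C)) <= normc (charfun (s + t%:C)) * b.
  rewrite mulrC ler_wpM2l ?normc_ge0 // (le_trans (ler_norm _)) //.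
  by rewrite lerDl.
have := normc_leB (X s) (X (s + t%:C)); rewrite normcB => h5.
by exfalso; lra.
Qed.

Lemma cont_delay s : cont (fun z => cexp (delay * z)) s.
Proof. exact: cont_cexp. Qed.

Lemma loop_sensitivities :
  [/\ quotient_of_charfun (sensitivity P C tau) (horner (dP * dC)),
      quotient_of_charfun (fun s => P s * sensitivity P C tau s)
        (horner (nP * dC)),
      quotient_of_charfun (fun s => C s * sensitivity P C tau s)
        (horner (dP * nC)) &
      quotient_of_charfun (compl_sensitivity P C tau)
        (fun z => (nP * nC).[z] * cexp (delay * z))].
Proof.
split; split.
1,3,5: by move=> s; exact: cont_horner.
4: by move=> s; exact: (contM (@cont_horner _ (nP * nC) s) (@cont_delay s)).
all: move=> z /loopE[Pz Cz PE CE]; rewrite charfunE => Dz.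
all: rewrite /compl_sensitivity /sensitivity /loop_gain PE CE -mulNr !hornerM.
all: have Dz' : dP.[z] * dC.[z] + nP.[z] * nC.[z] * cexp (delay * z) != 0 by [].
all: by field; rewrite Pz Cz /= ?andbT; apply: contra_neq Dz' => <-; ring.
Qed.

Hypothesis P_coprime : forall z, 0 <= Re z -> ~~ (root nP z && root dP z).
Hypothesis C_coprime : forall z, 0 <= Re z -> ~~ (root nC z && root dC z).
Hypothesis loop_stable : internally_stable P C tau.

Local Notation T := (regularize (compl_sensitivity P C tau)).

(** At a zero of the characteristic function the four numerators [dP dC],
    [nP dC], [dP nC] and [nP nC exp (- tau s)] would all vanish, which forces a
    common root of [nP] and [dP] or of [nC] and [dC]. *)
Lemma charfun_neq0 s : 0 <= Re s -> charfun s != 0.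
Proof.
move=> s0; apply: contraT => /negbNE/eqP Ds.
have [q1 q2 q3 q4] := loop_sensitivities.
have [s1 s2 s3 s4] := loop_stable.
have := stable_quotient_eq0 q1 s1 s0 Ds.
have := stable_quotient_eq0 q2 s2 s0 Ds.
have := stable_quotient_eq0 q3 s3 s0 Ds.
have /= := stable_quotient_eq0 q4 s4 s0 Ds.
move: (P_coprime s0) (C_coprime s0); rewrite !rootE !hornerM => pc cc.
move/eqP; rewrite !mulf_eq0 (negbTE (cexp_neq0 _)) orbF => h4.
move/eqP; rewrite mulf_eq0 => h3.
move/eqP; rewrite mulf_eq0 => h2.
move/eqP; rewrite mulf_eq0 => h1.
move: pc cc h1 h2 h3 h4.
by do 4 case: (_ == 0).
Qed.

Lemma compl_sensitivityE s : 0 <= Re s ->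
  T s = (nP * nC).[s] * cexp (delay * s) / charfun s.
Proof.
move=> s0; have [_ _ _ q] := loop_sensitivities.
exact: (regularize_quotient q (charfun_neq0 s0)).
Qed.

(** [T] is continuous at the points of the imaginary axis, and these are limits
    of points of the open half plane. *)
Lemma hinf_norm_ge_axis (w : R) : normc (T (0 +i* w)) <= hinf_norm T.
Proof.
have [_ _ _ [_ [B HB]]] := loop_stable.
have Dw : 0 <= Re (0 +i* w : R[i]) by [].
apply/ler_addgt0Pr => e e0.
pose X z := (nP * nC).[z] * cexp (delay * z) / charfun z.
have cX : cont X (0 +i* w).
  apply: (contM (contM (@cont_horner _ (nP * nC) _) (@cont_delay _))).
  exact: (contV (charfun_neq0 Dw) (@cont_epoly _ _ _ _ _)).
have [d d0 Hd] := (contP X _).1 cX e e0.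
pose z := 0 +i* w + (d / 2)%:C.
have z0 : 0 < Re z by rewrite /z ReD /= add0r divr_gt0.
have : normc (z - 0 +i* w) < d.
  rewrite /z addrAC subrr add0r normcC gtr0_norm ?divr_gt0 //; lra.
move=> /Hd; rewrite /X -!compl_sensitivityE ?(ltW z0) // => Td.
have Tz : normc (T z) <= hinf_norm T.
  apply: ub_le_sup; last by exists z.
  by exists B => _ [y y0 <-]; exact: HB.
have := normc_leB (T (0 +i* w)) (T z); rewrite normcB lerBlDr => /le_trans.
by apply; exact: lerD Tz (ltW Td).
Qed.

(** The polynomial [nB] stands for the numerator [nP] of the plant after
    reflection of its right half plane zeros (division by a Blaschke product).
    With [G = nB nC / charfun], [|G| = |T|] on the axis and [dP p = 0] makes the
    characteristic function at [p] equal to [nP nC exp (- tau p)], so that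
    [|G p| = V]. *)
Lemma hinf_lower_bound (nB : {poly R[i]}) (p : R[i]) :
  (size (nB * nC)%R < size (dP * dC)%R)%N ->
  (forall w : R, normc nB.[0 +i* w] = normc nP.[0 +i* w]) ->
  0 <= Re p -> root dP p -> nB.[p] != 0 ->
  let V := normc nB.[p] / normc nP.[p] * expR (tau * Re p) in
  V <= hinf_norm T /\ V <= hinf_norm_axis T.
Proof.
move=> nB_size nB_axis p0 /rootP dPp nBp V.
pose G z := epoly delay (nB * nC) 0 z / charfun z.
have GE z : G z = (nB * nC).[z] / charfun z.
  by rewrite /G /epoly horner0 mul0r addr0.
have Dp : charfun p = nP.[p] * nC.[p] * cexp (delay * p).
  by rewrite charfunE dPp mul0r add0r.
have := charfun_neq0 p0; rewrite Dp !mulf_eq0 !negb_or.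
move=> /andP[/andP[nPp nCp] _].
have Gp : normc (G p) = V.
  rewrite GE Dp hornerM !(normcM, normcV, normcX) normc_delay.
  rewrite mulNr expRN /V.
  have h1 : normc nP.[p] != 0 by rewrite normc_eq0.
  have h2 : normc nC.[p] != 0 by rewrite normc_eq0.
  have h3 : expR (tau * Re p) != 0 by rewrite gt_eqF ?expR_gt0.
  by field; rewrite h1 h2 h3.
have GT (w : R) : normc (G (0 +i* w)) = normc (T (0 +i* w)).
  rewrite GE compl_sensitivityE // !hornerM !normcM nB_axis normc_delay /=.
  by rewrite mulr0 expR0 mulr1.
have [|||w Gw] := @max_on_axis R delay (nB * nC) 0 (dP * dC) (nP * nC) p _ _ p0.
- exact: charfun_neq0.
- move=> e e0.
  have [|r1 H1] := horner_dominated nB_size (e := e / 4).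
    by rewrite divr_gt0.
  have [r2 H2] := charfun_lower.
  exists (Num.max r1 r2) => z z0; rewrite ge_max.
  move=> /andP[/H1[Dz Nz] /(H2 z z0)[Cz Bz]].
  rewrite -/(G z) GE normcM normcV ltr_pdivrMr ?normc_gt0 //.
  apply: le_lt_trans Nz _.
  have : 0 < normc (charfun z) by rewrite normc_gt0.
  move: Bz e0; nra.
- rewrite -/(G p) GE Dp hornerM !mulf_neq0 ?invr_neq0 //.
  by rewrite !mulf_neq0 ?cexp_neq0.
have {}Gw z : 0 <= Re z -> normc (G z) <= normc (G (0 +i* w)) by exact: Gw.
have VT : V <= normc (T (0 +i* w)) by rewrite -Gp -GT; exact: Gw.
split; first exact: le_trans VT (hinf_norm_ge_axis w).
apply: le_trans VT _; apply: ub_le_sup; last by exists w.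
exists (normc (G (0 +i* w))) => _ [y _ <-].
by rewrite -GT; exact: Gw.
Qed.

End ClosedLoop.

(** Dividing by the greatest common divisor keeps the quotient except at the
    roots of the original denominator [E], and preserves properness. *)
Lemma proper_real_rationalP (R : realType) (C : R[i] -> R[i]) :
  proper_real_rational C -> exists nC dC E : {poly R[i]},
  [/\ E != 0, dC != 0, (size nC <= size dC)%N,
      forall z, ~~ (root nC z && root dC z) &
      forall z, E.[z] != 0 -> dC.[z] != 0 /\ C z = nC.[z] / dC.[z]].
Proof.
move=> [num [den [den0 nd CE]]].
pose toC := map_poly (real_complex R).
pose g := gcdp num den.
have g0 : g != 0 by rewrite gcdp_eq0 (negbTE den0) andbF.
have numE : num = num %/ g * g by rewrite divpK ?dvdp_gcdl.
have denE : den = den %/ g * g by rewrite divpK ?dvdp_gcdr.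
have d0 : den %/ g != 0 by apply: contraNneq den0 => d0; rewrite denE d0 mul0r.
exists (toC (num %/ g)), (toC (den %/ g)), (toC den); split.
- by rewrite map_poly_eq0.
- by rewrite map_poly_eq0.
- rewrite !size_map_poly; have [->|n0] := eqVneq (num %/ g) 0.
    by rewrite size_poly0.
  have : (0 < size g)%N by rewrite size_poly_gt0.
  move: nd; rewrite {1}numE {1}denE !size_mul //.
  by case: (size g) => // k; rewrite !addnS /= leq_add2r.
- move=> z; apply/negP => /andP[nz /rootP dz].
  have : coprimep (toC (num %/ g)) (toC (den %/ g)).
    by rewrite coprimep_map coprimep_div_gcd // den0 orbT.
  by move/coprimep_root/(_ nz); rewrite dz eqxx.
- move=> z Ez; rewrite (CE z Ez).
  have nE : toC num = toC (num %/ g) * toC g by rewrite {1}numE /toC rmorphM.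
  have dE : toC den = toC (den %/ g) * toC g by rewrite {1}denE /toC rmorphM.
  move: Ez; rewrite -!/(toC _) nE dE !hornerM mulf_eq0 negb_or.
  move=> /andP[dz gz]; split=> //.
  by rewrite -mulf_div divff // mulr1.
Qed.
(** * The pendulum *)

Section Pendulum.
Context {R : realType}.
Variables (M m l l0 g : R).
Hypotheses (M_gt0 : 0 < M) (m_gt0 : 0 < m) (l_gt0 : 0 < l) (g_gt0 : 0 < g).

Local Notation p := (pendulum_pole M m l g).
Local Notation q := (pendulum_zero l l0 g).

Definition pendulum_num : {poly R[i]} := (l - l0)%:C *: 'X^2 - g%:C%:P.
Definition pendulum_den : {poly R[i]} :=
  'X^2 * ((M * l)%:C *: 'X^2 - ((M + m) * g)%:C%:P).

Lemma horner_pendulum_num z : pendulum_num.[z] = (l - l0)%:C * z ^+ 2 - g%:C.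
Proof. by rewrite hornerD hornerN hornerZ hornerXn hornerC. Qed.

Lemma horner_pendulum_den z :
  pendulum_den.[z] = z ^+ 2 * ((M * l)%:C * z ^+ 2 - ((M + m) * g)%:C).
Proof. by rewrite hornerM hornerD hornerN hornerZ !hornerXn hornerC. Qed.

Lemma size_pendulum_num : (size pendulum_num <= 3)%N.
Proof.
rewrite (leq_trans (size_polyD _ _)) // geq_max size_polyN.
rewrite (leq_trans (size_scale_leq _ _)) ?size_polyXn //=.
exact: leq_trans (size_polyC_leq1 _) _.
Qed.

Lemma size_pendulum_den : size pendulum_den = 5%N.
Proof.
have Ml0 : (M * l)%:C != 0 by rewrite fmorph_eq0 mulf_neq0 ?gt_eqF.
have s3 : size ((M * l)%:C *: 'X^2 - ((M + m) * g)%:C%:P) = 3%N.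
  rewrite size_polyDl size_scale ?size_polyXn //.
  by rewrite size_polyN (leq_ltn_trans (size_polyC_leq1 _)).
rewrite /pendulum_den size_mul ?s3 ?size_polyXn //.
  by rewrite -size_poly_eq0 size_polyXn.
by rewrite -size_poly_eq0 s3.
Qed.

Lemma pendulum_pole_sqr : M * l * p ^+ 2 = (M + m) * g.
Proof.
rewrite sqr_sqrtr; last by rewrite ltW // divr_gt0 ?mulr_gt0 ?addr_gt0.
by rewrite mulrC divfK // mulf_neq0 ?gt_eqF.
Qed.

Lemma pendulum_zero_sqr : l0 < l -> (l - l0) * q ^+ 2 = g.
Proof.
rewrite -subr_gt0 => ll0.
rewrite sqr_sqrtr; last by rewrite ltW // divr_gt0.
by rewrite mulrC divfK // gt_eqF.
Qed.

Lemma pendulum_pole_gt0 : 0 < p.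
Proof. by rewrite sqrtr_gt0 divr_gt0 ?mulr_gt0 ?addr_gt0. Qed.

(** A common root [z] is non-zero and has [(l - l0) z^2 = g] and
    [M l z^2 = (M + m) g]; hence [l0 < l] and [p^2 = q^2]. *)
Lemma pendulum_coprime z : (l0 < l -> p != q) ->
  ~~ (root pendulum_num z && root pendulum_den z).
Proof.
move=> pq; apply/negP => /andP[/rootP + /rootP].
rewrite horner_pendulum_num horner_pendulum_den => nz /eqP.
have {nz} nz : (l - l0)%:C * z ^+ 2 = g%:C by apply/eqP; rewrite -subr_eq0 nz.
have g0 : g%:C != 0 by rewrite fmorph_eq0 gt_eqF.
rewrite mulf_eq0 => /orP[/eqP z0|]; first by rewrite -nz z0 mulr0 eqxx in g0.
rewrite subr_eq0 => /eqP dz.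
have : (l - l0)%:C * ((M + m) * g)%:C = (M * l)%:C * g%:C.
  by rewrite -dz mulrCA nz.
rewrite -!rmorphM => /complexI; rewrite mulrA => /(mulIf (lt0r_neq0 g_gt0)) e.
have ll0 : l0 < l.
  by rewrite -subr_gt0 -(pmulr_lgt0 _ (addr_gt0 M_gt0 m_gt0)) e mulr_gt0.
have /eqP[] := pq ll0; rewrite /pendulum_pole /pendulum_zero -e.
congr Num.sqrt; field.
by rewrite subr_eq0 (gt_eqF ll0) gt_eqF ?addr_gt0.
Qed.

End Pendulum.

Lemma ler_ln_expR (R : realType) (F x : R) : expR F <= x -> F <= ln x.
Proof.
move=> Fx; rewrite -[leLHS]expRK ler_ln // posrE ?expR_gt0 //.
exact: lt_le_trans (expR_gt0 _) Fx.
Qed.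

Theorem theorem2 (R : realType) (M m l g l0 tau : R) (C : R[i] -> R[i])
    (M_gt0 : 0 < M) (m_gt0 : 0 < m) (l_gt0 : 0 < l) (g_gt0 : 0 < g)
    (l0_ge0 : 0 <= l0) (tau_ge0 : 0 <= tau)
    (C_proper : proper_real_rational C)
    (CL_stable : internally_stable (pendulum M m l l0 g) C tau)
    (p_neq_q : l0 < l -> pendulum_pole M m l g != pendulum_zero l l0 g) :
  let T := regularize (compl_sensitivity (pendulum M m l l0 g) C tau) in
  fragility M m l l0 g tau <= ln (hinf_norm T) /\
  fragility M m l l0 g tau <= ln (hinf_norm_axis T).
Proof.
move=> T; set p := pendulum_pole M m l g; set q := pendulum_zero l l0 g.
have [nC [dC [E [E0 dC0 nd coC CE]]]] := proper_real_rationalP C_proper.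
pose nP := pendulum_num l l0 g; pose dP := pendulum_den M m l g.
have sdP : size dP = 5%N by exact: size_pendulum_den.
have dP0 : dP != 0 by rewrite -size_poly_eq0 sdP.
have snP : (size nP <= 3)%N by exact: size_pendulum_num.
have proper (nB : {poly R[i]}) : (size nB <= 3)%N ->
    (size (nB * nC)%R < size (dP * dC)%R)%N.
  move=> nB3; rewrite [ltnRHS]size_mul // sdP.
  apply: leq_ltn_trans (size_polyMleq _ _) _.
  have : (0 < size dC)%N by rewrite size_poly_gt0.
  move: nd nB3; move: (size nB) (size nC) (size dC) => a b [|c] // bc a3 _; lia.
have EP : dP * E != 0 by rewrite mulf_neq0.
have loopE z : (dP * E).[z] != 0 -> [/\ dP.[z] != 0, dC.[z] != 0,
    pendulum M m l l0 g z = nP.[z] / dP.[z] & C z = nC.[z] / dC.[z]].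
  rewrite hornerM mulf_eq0 negb_or => /andP[Pz /CE[Cz ->]]; split=> //.
  by rewrite horner_pendulum_num horner_pendulum_den.
have bound nB := hinf_lower_bound tau_ge0 loopE EP (proper nP snP)
  (fun z _ => @pendulum_coprime _ M m l l0 g M_gt0 m_gt0 l_gt0 g_gt0 z p_neq_q)
  (fun z _ => coC z) CL_stable (nB := nB) (p := p%:C).
have p_gt0 : 0 < p by exact: pendulum_pole_gt0.
have p2 : M * l * p ^+ 2 = (M + m) * g by exact: pendulum_pole_sqr.
have dPp : root dP p%:C.
  by rewrite rootE horner_pendulum_den -rmorphXn -rmorphM p2 subrr mulr0.
have nPp : nP.[p%:C] = ((l - l0) * p ^+ 2 - g)%:C.
  by rewrite horner_pendulum_num -rmorphXn -rmorphM -rmorphB.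
suff [nB [nB3 nBw nBp Vp]] : exists nB : {poly R[i]}, [/\ (size nB <= 3)%N,
    forall w : R, normc nB.[0 +i* w] = normc nP.[0 +i* w], nB.[p%:C] != 0 &
    normc nB.[p%:C] / normc nP.[p%:C] * expR (tau * p) =
      expR (fragility M m l l0 g tau)].
  have [] := bound nB (proper nB nB3) nBw (ltW p_gt0) dPp nBp.
  by rewrite [complex.Re _]/= Vp => h1 h2; split; exact: ler_ln_expR.
(* For [l <= l0] the plant has no right half plane zero and [nB = nP]; otherwise
   [nP = (l - l0) (z - q) (z + q)] and the zero [q] is reflected to [- q]. *)
rewrite /fragility -/p -/q; case: ifPn => [ll0|]; last first.
  rewrite -leNgt => ll0; exists nP.
  have nPp0 : nP.[p%:C] != 0.
    rewrite nPp fmorph_eq0 lt_eqF // subr_lt0.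
    by rewrite (le_lt_trans _ g_gt0) // mulr_le0_ge0 ?sqr_ge0 // subr_le0.
  by split=> //; rewrite divff ?mul1r // normc_eq0.
have q2 : (l - l0) * q ^+ 2 = g by exact: pendulum_zero_sqr.
have ll1 : 0 < l - l0 by rewrite subr_gt0.
have q_gt0 : 0 < q by rewrite sqrtr_gt0 divr_gt0.
exists ((l - l0)%:C *: ('X + q%:C%:P) ^+ 2).
have nBE z : ((l - l0)%:C *: ('X + q%:C%:P) ^+ 2).[z] =
    (l - l0)%:C * (z + q%:C) ^+ 2.
  by rewrite hornerZ horner_exp hornerD hornerX hornerC.
have pq : p - q != 0 by rewrite subr_eq0 p_neq_q.
have pDq : p + q != 0 by rewrite gt_eqF ?addr_gt0.
split.
- rewrite (leq_trans (size_scale_leq _ _)) // -[q%:C]opprK polyCN.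
  by rewrite size_exp_XsubC.
- move=> w; rewrite nBE horner_pendulum_num normcM normcX normcC gtr0_norm //.
  have -> : (l - l0)%:C * (0 +i* w) ^+ 2 - g%:C =
      (- ((l - l0) * w ^+ 2 + g))%:C.
    by apply/eqP; rewrite eq_complex /=; apply/andP; split; apply/eqP; ring.
  rewrite normcC normrN ger0_norm; last first.
    by apply: addr_ge0 (ltW g_gt0); rewrite mulr_ge0 ?sqr_ge0 ?(ltW ll1).
  rewrite /= add0r addr0 sqr_sqrtr ?addr_ge0 ?sqr_ge0 //.
  by rewrite mulrDr q2 addrC.
- rewrite nBE -rmorphD -rmorphXn -rmorphM fmorph_eq0.
  by rewrite mulf_neq0 ?expf_neq0 // gt_eqF.
- rewrite nBE nPp -rmorphD -rmorphXn -rmorphM !normcC expRD mulrC.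
  congr (_ * _); rewrite lnK ?posrE ?normr_gt0 ?mulf_neq0 ?invr_neq0 //.
  rewrite -normfV -normrM; congr `|_|; rewrite -q2; field.
  have -> : (l - l0) * p ^+ 2 - (l - l0) * q ^+ 2 =
    (l - l0) * (p - q) * (p + q) by ring.
  by rewrite pq !mulf_neq0 // gt_eqF.
Qed.
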